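(* Let $K$ be a field, let $I\subset S=K[x_1,\ldots,x_n]$ be a non-zero monomial ideal, let $\rho=\mathrm{projdim}(I)$ and let $d=\max\{\deg(u) : u\in\mathcal{G}(I)\}$. Then: (i) $t^S_{i+1}(I)\leq t^S_i(I)+d$ for all $i\geq 0$; (ii) $\mathrm{reg}(I)\leq \rho(d-1)+d$.
   Context: $S$ has the standard grading. $\mathcal{G}(I)$ denotes the unique minimal set of monomial generators of a monomial ideal $I$. For a finitely generated graded $S$-module $M$: the graded Betti numbers are $\beta^K_{i,j}(M)=\dim_K\mathrm{Tor}^S_i(K,M)_j$; the projective dimension is $\mathrm{projdim}(M)=\sup\{i : \mathrm{Tor}^S_i(K,M)\neq 0\}$; $t^S_i(M)=\max\{j : \beta^K_{i,j}(M)\neq 0\}$, with $t^S_i(M)=-\infty$ if $\mathrm{Tor}^S_i(K,M)=0$; and the Castelnuovo–Mumford regularity is $\mathrm{reg}(M)=\sup\{t^S_i(M)-i : i\ge 0\}$. Here $I$ itself (not $S/I$) is the module. *)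

(* Defs.v *)
From HB Require Import structures.
From mathcomp Require Import all_boot all_order all_algebra.
From mathcomp Require Import mpoly.
From mathcomp Require Import boolp classical_sets constructive_ereal.
From mathcomp Require Import zify.

Set Implicit Arguments.
Unset Strict Implicit.
Unset Printing Implicit Defensive.

Import Order.TTheory GRing.Theory Num.Theory.

Local Open Scope classical_set_scope.
Local Open Scope ring_scope.

(* A monomial x^m is represented by its exponent m : 'X_{1..n}. *)
Definition ideal_of_monomials (K : fieldType) (n : nat) (A : set 'X_{1..n}) :
    set {mpoly K[n]} :=
  [set f | exists2 s : seq ({mpoly K[n]} * 'X_{1..n}),
     (forall p, p \in s -> A p.2) & f = \sum_(p <- s) p.1 * 'X_[p.2]].

Arguments ideal_of_monomials K {n} A _.

Definition monomial_ideal (K : fieldType) (n : nat) (I : set {mpoly K[n]}) :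
    Prop :=
  exists A : set 'X_{1..n}, I = ideal_of_monomials K A.

Definition minimal_monomial_generators (K : fieldType) (n : nat)
    (I : set {mpoly K[n]}) (G : set 'X_{1..n}) : Prop :=
  I = ideal_of_monomials K G /\
  forall A : set 'X_{1..n}, A `<=` G -> I = ideal_of_monomials K A -> A = G.

Definition is_maximum (A : set nat) (d : nat) : Prop :=
  A d /\ forall e, A e -> (e <= d)%N.

Lemma supremum_ereal_int (A : set (\bar int)) : isLub A (supremum -oo%E A).
Proof.
have [->|A0] := eqVneq A set0.
  by rewrite supremum0; split=> [x []|b _]; rewrite ?leNye.
suff [m Am] : exists m, isLub A m.
  rewrite /supremum (negPf A0); case: xgetP => [y _ [] //|/(_ m)].
  by case.
have [[z Az]|nub] := pselect (exists z : int, ubound A z%:E); last first.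
  exists +oo%E; split=> [x _|[r||] // ub]; rewrite ?leey //.
  - by case: nub; exists r.
  - by case: nub; exists 0 => x /ub /le_trans; apply; rewrite leNye.
have [[y Ay]|nA] := pselect (exists y : int, A y%:E); last first.
  exists -oo%E; split=> [[r||] Ax //|b _]; rewrite ?leNye //.
  - by case: nA; exists r.
  - by have := Az _ Ax.
have Py : exists k, [pred k : nat | `[< ubound A (y + k%:Z)%:E >]] k.
  exists `|z - y|%N; apply/asboolP => x /Az /le_trans; apply; rewrite lee_fin; lia.
case: (ex_minnP Py) => k /asboolP ubk mink.
exists (y + k%:Z)%:E; split=> // -[r||] ub; rewrite ?leey //.
  have := ub _ Ay; rewrite !lee_fin => yr.
  suff : (k <= `|r - y|)%N by lia.
  apply: mink; apply/asboolP => x /ub /le_trans; apply; rewrite lee_fin; lia.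
by have := ub _ Ay.
Qed.

(* A resolution  ... -> F_1 -> F_0 -> I -> 0  of the ideal I by graded free   *)
(* modules F_i = \bigoplus_b S(- shift b) of finite rank and degree-preserving *)
(* maps. Elements of F_i are row vectors, on which the maps act on the right.  *)
Record graded_free_resolution (K : fieldType) (n : nat)
    (I : set {mpoly K[n]}) := GradedFreeResolution {
  res_rank : nat -> nat;
  res_shift : forall i, 'I_(res_rank i) -> int;
  res_aug : 'cV[{mpoly K[n]}]_(res_rank 0);
  res_diff : forall i, 'M[{mpoly K[n]}]_(res_rank i.+1, res_rank i);
  res_aug_homog : forall b m,
    m \in msupp (res_aug b 0) -> (mdeg m)%:Z = res_shift b;
  res_diff_homog : forall i a b m,
    m \in msupp (res_diff i a b) -> (mdeg m)%:Z + res_shift b = res_shift a;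
  res_aug_image : range (fun v : 'rV_(res_rank 0) => (v *m res_aug) 0 0) = I;
  res_exact0 : forall v : 'rV_(res_rank 0),
    v *m res_aug = 0 <-> exists w, v = w *m res_diff 0;
  res_exactS : forall i (v : 'rV_(res_rank i.+1)),
    v *m res_diff i = 0 <-> exists w, v = w *m res_diff i.+1
}.

Section Tor.
Context (K : fieldType) (n : nat) (I : set {mpoly K[n]}).
Variable F : graded_free_resolution I.

(* As K = S / (x_1, ..., x_n), tensoring the free module F_i with K gives      *)
(* K^(rank F_i), and reduces the matrix of the differential modulo the         *)
(* variables, that is, to the constant coefficients of its entries.            *)
Definition tensor_diff (i : nat) : 'M[K]_(res_rank F i.+1, res_rank F i) :=
  map_mx (mcoeff 0%MM) (res_diff F i).

(* As row spaces: the degree j component of K \otimes F_i, spanned by the      *)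
(* basis vectors of degree j, and its cycles and boundaries.                   *)
Definition tensor_comp (i : nat) (j : int) : 'M[K]_(res_rank F i) :=
  diag_mx (\row_b (@res_shift _ _ _ F i b == j)%:R).

Definition tensor_cycles (i : nat) (j : int) : 'M[K]_(res_rank F i) :=
  match i with
  | 0 => tensor_comp 0 j
  | i'.+1 => (tensor_comp i'.+1 j :&: kermx (tensor_diff i'))%MS
  end.

Definition tensor_boundaries (i : nat) (j : int) :
    'M[K]_(res_rank F i.+1, res_rank F i) :=
  tensor_comp i.+1 j *m tensor_diff i.

(* dim_K Tor_i^S(K, I)_j, with Tor computed from the resolution F of I. *)
Definition betti (i : nat) (j : int) : nat :=
  \rank (tensor_cycles i j) - \rank (tensor_boundaries i j).

(* As F_i has finite rank, this supremum is a maximum unless the set is empty, *)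
(* in which case it is -oo.                                                    *)
Definition tmax (i : nat) : \bar int :=
  supremum -oo%E [set j%:E | j in [set j : int | betti i j != 0%N]].

Definition projdim : \bar int :=
  supremum -oo%E [set (i%:Z)%:E | i in [set i : nat | exists j, betti i j != 0%N]].

Definition reg : \bar int :=
  supremum -oo%E (range (fun i : nat => tmax i - (i%:Z)%:E)%E).

End Tor.

(* Main.v *)
From HB Require Import structures.
Require Import Defs.
From mathcomp Require Import all_boot all_order all_algebra.
From mathcomp Require Import mpoly.
From mathcomp Require Import boolp classical_sets constructive_ereal.
From mathcomp Require Import zify.

(* Betti numbers may be computed from any graded free resolution, so F can be *)
(* replaced by a Taylor-type resolution, multigraded by lcms, whose basis in  *)
(* homological degree i consists of all (i+1)-tuples of generators. After     *)
(* tensoring with K it splits according to the lcm of the tuples. Let c be a  *)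
(* cycle of tuples with lcm a, in homological degree i+1, and let u be a      *)
(* generator dividing a. In the acyclic complex of all tuples, z = bd c lives *)
(* strictly below a, and the cone with apex u contracts whatever remains      *)
(* below a after joining with u. The obstruction to filling z below a thus    *)
(* comes from multidegrees b < a with lcm(u, b) = a, so that                  *)
(* deg b < deg a <= deg b + d. If Tor_i(I)_b vanishes for all of them, then   *)
(* z = bd w with w below a, and the lcm = a part of the cone over the full    *)
(* cycle c - w has boundary c. Hence every degree j of Tor_{i+1} comes with a *)
(* degree j' of Tor_i such that j' < j <= j' + d.                             *)

Set Implicit Arguments.
Unset Strict Implicit.
Unset Printing Implicit Defensive.

Import Order.TTheory GRing.Theory Num.Theory.

Local Open Scope classical_set_scope.
Local Open Scope ring_scope.

(** Both bounds come from one fact: every degree [j] of Tor_{i+1}(I) comes with a degree [j'] of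
    Tor_i(I) such that [j' < j <= j' + d]. It is [taylor_betti_eq0], whose core is the filling
    argument of [cycle_below] and [multidegree_exact]; [betti_unique] transfers it from the
    resolution on tuples of generators to [F]. Maximizing over [j] gives (i). As Tor_0(I) lives in
    degrees at most [d], iteration gives [j <= d * (i + 1)], that is [j - i <= i * (d - 1) + d]. For
    [d > 0], bounding [i] by [projdim F] gives (ii); for [d = 0], the strict inequality [j' < j]
    leaves only Tor_0(I). *)

Section Monomials.
Context (n : nat).
Implicit Types (m : 'X_{1..n}).

Lemma mdeg_lem m1 m2 : (m1 <= m2)%MM -> (mdeg m1 <= mdeg m2)%N.
Proof. by move=> le12; rewrite -(submK le12) mdegD leq_addl. Qed.

Lemma mdeg_ltm m1 m2 : (m1 <= m2)%MM -> m1 != m2 -> (mdeg m1 < mdeg m2)%N.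
Proof.
move=> le12; apply: contra_neqT; rewrite -leqNgt -{1 2}(submK le12) mdegD.
rewrite -[X in (_ <= X)%N]add0n leq_add2r leqn0 mdeg_eq0 => /eqP ->.
by rewrite add0m.
Qed.

Lemma lem_antisym m1 m2 : (m1 <= m2)%MM -> (m2 <= m1)%MM -> m1 = m2.
Proof.
move=> le12 le21; apply/mnmP => k; apply/eqP.
by rewrite eqn_leq (mnm_lepP le12) (mnm_lepP le21).
Qed.

Lemma mdeg_mlcm m1 m2 : (mdeg (mlcm m1 m2) <= mdeg m1 + mdeg m2)%N.
Proof. by rewrite mlcmE mdegD leq_add2l mdegB. Qed.

End Monomials.

(** * Selecting the terms of a polynomial by their monomials *)

Section MonomialFilter.
Context (K : fieldType) (n : nat).
Implicit Types (P Q : pred 'X_{1..n}) (p q : {mpoly K[n]}) (m : 'X_{1..n}).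

Definition mfilter P p : {mpoly K[n]} :=
  \sum_(m <- msupp p | P m) p@_m *: 'X_[m].

Lemma mcoeff_mfilter P p m : (mfilter P p)@_m = if P m then p@_m else 0.
Proof.
rewrite /mfilter raddf_sum /=.
rewrite (eq_bigr (fun k => p@_k * (k == m)%:R)); last first.
  by move=> k _; rewrite mcoeffZ mcoeffX.
have [mp|mp] := boolP (m \in msupp p); last first.
  rewrite (memN_msupp_eq0 mp) if_same big_seq_cond big1 // => k /andP[kp _].
  by have [km|] := eqVneq k m; rewrite ?mulr0 // -km kp in mp *.
rewrite big_mkcond (bigD1_seq m) ?msupp_uniq //= eqxx mulr1 big1 ?addr0 // => k.
by move=> /negPf ->; rewrite mulr0 if_same.
Qed.

Lemma mfilter_is_linear P : linear (mfilter P).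
Proof.
move=> c p q; apply/mpolyP => m; rewrite mcoeffD mcoeffZ !mcoeff_mfilter.
by rewrite mcoeffD mcoeffZ; case: ifP => // _; rewrite mulr0 addr0.
Qed.

HB.instance Definition _ P :=
  GRing.isLinear.Build K {mpoly K[n]} {mpoly K[n]} _ (mfilter P)
    (mfilter_is_linear P).

Lemma mfilterZX P c m :
  mfilter P (c *: 'X_[m]) = if P m then c *: 'X_[m] else 0.
Proof.
apply/mpolyP => k; rewrite mcoeff_mfilter (fun_if (mcoeff k)) mcoeff0 mcoeffZ.
by rewrite mcoeffX; have [->|] := eqVneq m k; rewrite ?mulr0 ?if_same.
Qed.

Lemma msupp_mfilter P p m :
  (m \in msupp (mfilter P p)) = P m && (m \in msupp p).
Proof. by rewrite !mcoeff_msupp mcoeff_mfilter; case: (P m); rewrite ?eqxx. Qed.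

Lemma mfilter_id P p : {in msupp p, forall m, P m} -> mfilter P p = p.
Proof.
move=> Pp; apply/mpolyP => m; rewrite mcoeff_mfilter.
by case: ifPn => // nPm; rewrite memN_msupp_eq0 //; apply: contra nPm => /Pp.
Qed.

(** For [q] homogeneous and [P], [Q] conditions on the degree, this says that multiplication by [q]
    commutes with taking homogeneous parts. *)
Lemma mfilterM P Q p q :
    {in msupp q, forall m' m, P (m + m')%MM = Q m} ->
  mfilter P (p * q) = mfilter Q p * q.
Proof.
move=> PQ; rewrite [p]mpolyE [q in LHS]mpolyE [q in RHS]mpolyE !raddf_sum /=.
rewrite !mulr_suml raddf_sum /=; apply: eq_bigr => m _.
rewrite !mulr_sumr raddf_sum big_seq [RHS]big_seq; apply: eq_bigr => m' m'q.
rewrite -scalerAr -scalerAl -mpolyXD scalerA /= !mfilterZX (PQ _ m'q).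
by case: (Q m); rewrite ?mul0r // -scalerAr -scalerAl -mpolyXD scalerA.
Qed.

Lemma mpolyX_neq0 m : 'X_[m] != 0 :> {mpoly K[n]}.
Proof. by rewrite -msupp_eq0 msuppX. Qed.

Lemma divide_mpolyX l p : {in msupp p, forall m, (l <= m)%MM} ->
  exists q, p = q * 'X_[l].
Proof.
move=> lp; exists (\sum_(m <- msupp p) p@_m *: 'X_[m - l]).
rewrite {1}(mpolyE p) mulr_suml big_seq [RHS]big_seq; apply: eq_bigr => m mp.
by rewrite -scalerAl -mpolyXD submK ?lp.
Qed.

Lemma lem_msuppMX l p m : m \in msupp (p * 'X_[l]) -> (l <= m)%MM.
Proof.
by rewrite (perm_mem (msuppMX p l)) => /mapP[k _ ->]; rewrite lem_addr.
Qed.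

End MonomialFilter.

(** * Chains on arbitrary vertex sequences, their boundary and cones *)

Section OrderedChains.
Context (T : finType).
Implicit Types (s t : seq T).

(* The boundary of the full simplicial set on the vertex set T, simplices     *)
(* being arbitrary sequences: the coefficient of bd c at t is the alternating *)
(* sum of c over all insertions of one vertex in t.                           *)
Fixpoint bd (V : zmodType) (c : seq T -> V) t : V :=
  \sum_g c (g :: t) -
    (if t is h :: t' then bd (fun s => c (h :: s)) t' else 0).

Section Zmod.
Context (V : zmodType).
Implicit Types (c : seq T -> V).

Lemma eq_bd c1 c2 t :
    (forall s, size s = (size t).+1 -> {subset t <= s} -> c1 s = c2 s) ->
  bd c1 t = bd c2 t.
Proof.
elim: t c1 c2 => [|h t IH] c1 c2 c12 /=.
  by congr (_ - _); apply: eq_bigr => g _; apply: c12.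
congr (_ - _).
  by apply: eq_bigr => g _; apply: c12 => // x xt; rewrite inE xt orbT.
apply: IH => s st ts; apply: c12 => /= [|x]; first by rewrite st.
by rewrite !inE => /predU1P[->|/ts ->]; rewrite ?eqxx ?orbT.
Qed.

Lemma bdD c1 c2 t : bd (fun s => c1 s + c2 s) t = bd c1 t + bd c2 t.
Proof.
elim: t c1 c2 => [|h t IH] c1 c2 /=; first by rewrite !subr0 big_split.
by rewrite IH big_split opprD addrACA.
Qed.

Lemma bdN c t : bd (fun s => - c s) t = - bd c t.
Proof.
elim: t c => [|h t IH] c /=; first by rewrite !subr0 sumrN.
by rewrite IH sumrN opprB opprK addrC.
Qed.

Lemma bdB c1 c2 t : bd (fun s => c1 s - c2 s) t = bd c1 t - bd c2 t.
Proof. by rewrite bdD bdN. Qed.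

Lemma bd0 t : bd (fun=> 0 : V) t = 0.
Proof. by elim: t => [|h t IH] /=; rewrite ?IH big1 ?subr0. Qed.

Lemma bd_eq0 c t :
    (forall s, size s = (size t).+1 -> {subset t <= s} -> c s = 0) ->
  bd c t = 0.
Proof. by move=> c0; rewrite -[RHS](bd0 t); apply: eq_bd. Qed.

Lemma bd_sum (I : finType) (c : I -> seq T -> V) t :
  bd (fun s => \sum_i c i s) t = \sum_i bd (c i) t.
Proof.
elim: t c => [|h t IH] c /=; last by rewrite IH exchange_big -sumrB.
by rewrite subr0 exchange_big; apply: eq_bigr => i _; rewrite subr0.
Qed.

Lemma bd_bd c t : bd (bd c) t = 0.
Proof.
elim: t c => [|h t IH] c /=.
  rewrite subr0 sumrB exchange_big.
  by under [X in _ - X]eq_bigr do rewrite subr0; rewrite subrr.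
rewrite sumrB.
rewrite (bdB (fun s => \sum_g c (g :: h :: s)) (bd (fun s => c (h :: s)))).
rewrite IH subr0 sumrB exchange_big /= bd_sum opprB addrCA subrr addr0.
by rewrite subrr.
Qed.

(* A contracting homotopy as soon as \sum_g p g is the identity.              *)
Definition cone (p : T -> V -> V) c s : V :=
  if s is g :: s' then p g (c s') else 0.

End Zmod.

Lemma bd_raddf (U V : zmodType) (f : {additive U -> V}) (c : seq T -> U) t :
  bd (fun s => f (c s)) t = f (bd c t).
Proof.
elim: t c => [|h t IH] c /=; first by rewrite !subr0 raddf_sum.
by rewrite IH raddfB raddf_sum.
Qed.

(** A vertex inserted in front of [h :: t] becomes the apex, which gives the sum; an insertion
    behind [h] keeps [h] as apex, which gives the other term. *)
Lemma bd_cone (V : zmodType) (p : T -> {additive V -> V}) (c : seq T -> V) h t :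
  bd (cone (fun g => p g) c) (h :: t) = \sum_g p g (c (h :: t)) - p h (bd c t).
Proof. by rewrite /= (bd_raddf (p h)). Qed.

Definition simplex_indicator (R : pzRingType) s : seq T -> R :=
  fun s' => (s' == s)%:R.

Lemma bd_scaler (R : pzRingType) (V : lmodType R) (a : seq T -> R) (v : V) t :
  bd (fun s => a s *: v) t = bd (V := R) a t *: v.
Proof.
elim: t a => [|h t IH] a /=; first by rewrite !subr0 scaler_suml.
by rewrite IH scalerBl scaler_suml.
Qed.

(** The matrix form of [bd], by linearity; its entries are the incidence numbers used in
    [taylor_diff]. *)
Lemma bd_tuples (R : pzRingType) (V : lmodType R) k (c : seq T -> V) t :
    size t = k ->
  bd c t =
  \sum_(s : k.+1.-tuple T) bd (V := R) (simplex_indicator R s) t *: c s.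
Proof.
move=> st; under eq_bigr do rewrite -bd_scaler.
rewrite -(bd_sum (fun (r : k.+1.-tuple T) s => simplex_indicator R r s *: c r)).
apply: eq_bd => s; rewrite st => /eqP ss _.
rewrite (bigD1 (Tuple ss)) //= big1 ?addr0.
  by rewrite /simplex_indicator eqxx scale1r.
move=> s' ne; rewrite /simplex_indicator; have [es|] := eqVneq s (val s').
  by case/eqP: ne; apply: val_inj.
by rewrite scale0r.
Qed.

Lemma bd_tuples_ring (R : pzRingType) k (c : seq T -> R) t :
    size t = k ->
  bd c t =
  \sum_(s : k.+1.-tuple T) bd (V := R) (simplex_indicator R s) t * c s.
Proof. exact: (@bd_tuples R R^o). Qed.

End OrderedChains.

(** * The Taylor-type resolution on all tuples of generators *)

Section TaylorResolution.
Context (K : fieldType) (n : nat) (T : finType) (gen : T -> 'X_{1..n}).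
Implicit Types (s t : seq T) (m : 'X_{1..n}) (i : nat).
Local Notation S := {mpoly K[n]}.

Definition lcm_gen s : 'X_{1..n} := foldr (fun g => mlcm (gen g)) 0%MM s.

Lemma lem_lcm_gen s m : (lcm_gen s <= m)%MM = all (fun g => gen g <= m)%MM s.
Proof.
elim: s => [|g s IH] /=; last by rewrite lem_mlcm IH.
by apply/mnm_lepP => j; rewrite mnm0E.
Qed.

Lemma gen_lem_lcm g s : g \in s -> (gen g <= lcm_gen s)%MM.
Proof.
by move: g; apply/allP; rewrite -lem_lcm_gen lepm_refl.
Qed.

Lemma lcm_gen_sub t s : {subset t <= s} -> (lcm_gen t <= lcm_gen s)%MM.
Proof. by move=> ts; rewrite lem_lcm_gen; apply/allP => g /ts /gen_lem_lcm. Qed.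

Lemma lcm_gen1 g : lcm_gen [:: g] = gen g.
Proof. by rewrite /lcm_gen /= mlcm0. Qed.

Definition incidence s t : K := bd (V := K) (simplex_indicator K s) t.

Lemma incidence_sub s t : incidence s t != 0 -> {subset t <= s}.
Proof.
move=> /eqP nz; apply/allP; apply: contra_notT nz => /allPn[x xt xs].
apply: bd_eq0 => s' _ ts'; rewrite /simplex_indicator; case: eqP => // ss'.
by rewrite -ss' ts' in xs.
Qed.

(** Tuples have length [i.+1] because [I], not S/I, is resolved: the empty tuple stands for S, the
    target of the augmentation. *)
Definition taylor_rank i := #|{: i.+1.-tuple T}|.

Definition simplex i (a : 'I_(taylor_rank i)) : i.+1.-tuple T := enum_val a.

Lemma simplexK i (s : i.+1.-tuple T) : simplex (enum_rank s) = s.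
Proof. exact: enum_rankK. Qed.

Definition taylor_shift i (a : 'I_(taylor_rank i)) : int :=
  (mdeg (lcm_gen (simplex a)))%:Z.

Definition taylor_aug : 'cV[S]_(taylor_rank 0) :=
  \col_a 'X_[lcm_gen (simplex a)].

Definition taylor_diff i : 'M[S]_(taylor_rank i.+1, taylor_rank i) :=
  \matrix_(a, b) (incidence (simplex a) (simplex b) *:
    'X_[lcm_gen (simplex a) - lcm_gen (simplex b)]).

Definition chain_of (V : zmodType) i (v : 'rV[V]_(taylor_rank i)) s : V :=
  if insub s is Some t then v 0 (enum_rank (t : i.+1.-tuple T)) else 0.

Lemma chain_of_tuple (V : zmodType) i (v : 'rV[V]_(taylor_rank i))
  (s : i.+1.-tuple T) : chain_of v s = v 0 (enum_rank s).
Proof. by rewrite /chain_of valK. Qed.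

Lemma chain_of_size (V : zmodType) i (v : 'rV[V]_(taylor_rank i)) s :
  size s != i.+1 -> chain_of v s = 0.
Proof. by move=> ss; rewrite /chain_of insubN. Qed.

Lemma chain_of_inj (V : zmodType) i (v w : 'rV[V]_(taylor_rank i)) :
  (forall s : i.+1.-tuple T, chain_of v s = chain_of w s) -> v = w.
Proof.
move=> vw; apply/rowP => a; have := vw (simplex a).
by rewrite !chain_of_tuple /simplex enum_valK.
Qed.

Definition row_of (V : zmodType) i (c : seq T -> V) : 'rV[V]_(taylor_rank i) :=
  \row_a c (simplex a).

Lemma row_ofK (V : zmodType) i (c : seq T -> V) s :
  size s = i.+1 -> chain_of (row_of i c) s = c s.
Proof.
move=> /eqP ss; rewrite (chain_of_tuple _ (Tuple ss)) mxE.
by rewrite simplexK.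
Qed.

Lemma chain_of_mulmx (R : pzRingType) i (v : 'rV[R]_(taylor_rank i.+1))
    (A : 'M[R]_(taylor_rank i.+1, taylor_rank i)) (t : i.+1.-tuple T) :
  chain_of (v *m A) t =
  \sum_(s : i.+2.-tuple T) chain_of v s * A (enum_rank s) (enum_rank t).
Proof.
rewrite chain_of_tuple mxE (reindex enum_rank) /=.
  by apply: eq_bigr => s _; rewrite chain_of_tuple.
by exists enum_val => ? _; rewrite (enum_rankK, enum_valK).
Qed.

(* Multiplying the coefficient of each s by x^(lcm s) turns the differential  *)
(* of the resolution into the plain boundary operator bd.                     *)
Definition homogenize i (v : 'rV[S]_(taylor_rank i)) s : S :=
  chain_of v s * 'X_[lcm_gen s].

(** A nonzero incidence forces [t] to be contained in [s], so the lcm of [t] divides that of [s] and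
    the subtraction of exponents is not truncated. *)
Lemma bd_homogenize i (v : 'rV[S]_(taylor_rank i.+1)) t : size t = i.+1 ->
  chain_of (v *m taylor_diff i) t * 'X_[lcm_gen t] = bd (homogenize v) t.
Proof.
move=> st; rewrite (bd_tuples _ st) -[t in LHS]/(tval (Tuple (introT eqP st))).
rewrite chain_of_mulmx mulr_suml; apply: eq_bigr => s _.
rewrite mxE !simplexK /= -/(incidence s t) /homogenize -!scalerAr -!scalerAl.
have [->|nz] := eqVneq (incidence s t) 0; first by rewrite !scale0r.
by rewrite -mulrA -mpolyXD submK // lcm_gen_sub //; apply: incidence_sub.
Qed.

Lemma taylor_augE (v : 'rV[S]_(taylor_rank 0)) :
  (v *m taylor_aug) 0 0 = bd (homogenize v) [::].
Proof.
rewrite mxE (bd_tuples _ (erefl : size [::] = 0%N)).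
rewrite (reindex enum_rank) /=; last first.
  by exists enum_val => ? _; rewrite (enum_rankK, enum_valK).
apply: eq_bigr => s _; rewrite mxE simplexK /homogenize chain_of_tuple.
suff -> : \sum_g simplex_indicator K s [:: g] = 1 by rewrite subr0 scale1r.
case/tupleP: s => g s; rewrite tuple0 (bigD1 g) //= big1 ?addr0.
  by rewrite /simplex_indicator eqxx.
by move=> h /negPf hg; rewrite /simplex_indicator eqseq_cons hg.
Qed.

Definition select_gen m : option T := [pick g | gen g <= m]%MM.

(** Each monomial is assigned to one chosen generator dividing it. The resulting projections are
    linear over K but not over S; [bd_cone] asks only for additivity. *)
Definition select_part (g : T) : {linear S -> S} :=
  mfilter [pred m | select_gen m == Some g].

Lemma sum_select_part (p : S) h : {in msupp p, forall m, (gen h <= m)%MM} ->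
  \sum_g select_part g p = p.
Proof.
move=> hp; apply/mpolyP => m; rewrite raddf_sum /=.
under eq_bigr do rewrite mcoeff_mfilter /=.
have [mp|mp] := boolP (m \in msupp p); last first.
  by rewrite memN_msupp_eq0 // big1 // => g _; rewrite if_same.
rewrite /select_gen; case: pickP => [g _|/(_ h)]; last by rewrite hp.
by rewrite (bigD1 g) //= eqxx big1 ?addr0 // => k kg; rewrite eq_sym ifN.
Qed.

Lemma exists_homogenize i (c : seq T -> S) :
    (forall s, {in msupp (c s), forall m, (lcm_gen s <= m)%MM}) ->
  exists v : 'rV_(taylor_rank i),
    forall s, size s = i.+1 -> homogenize v s = c s.
Proof.
move=> cs.
have /choice[q qc] s : exists q, c s = q * 'X_[lcm_gen s].
  exact/divide_mpolyX/cs.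
by exists (row_of i q) => s ss; rewrite /homogenize row_ofK.
Qed.

Lemma msupp_homogenize i (v : 'rV[S]_(taylor_rank i)) s :
  {in msupp (homogenize v s), forall m, (lcm_gen s <= m)%MM}.
Proof. by move=> m; apply: lem_msuppMX. Qed.

Lemma homogenize_inj i (v w : 'rV[S]_(taylor_rank i)) :
    (forall s, size s = i.+1 -> homogenize v s = homogenize w s) -> v = w.
Proof.
move=> vw; apply: chain_of_inj => s; apply: (mulIf (mpolyX_neq0 K (lcm_gen s))).
by apply: vw; rewrite size_tuple.
Qed.

(** In multidegree [m] the homogenized complex is the full complex on the generators dividing [m],
    contracted by the cone with apex [select_gen m]. The cone coefficient at [g :: s] involves only
    monomials divisible by both [gen g] and the lcm of [s], so it can be divided by the lcm of
    [g :: s]. *)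
Lemma taylor_exact i (v : 'rV[S]_(taylor_rank i)) :
    (forall t, size t = i -> bd (homogenize v) t = 0) ->
  exists w, v = w *m taylor_diff i.
Proof.
move=> bdv; pose c := cone (fun g => select_part g) (homogenize v).
have [|w wc] := @exists_homogenize i.+1 c.
  case=> [|g s] m; first by rewrite /c /= msupp0.
  rewrite /c /= msupp_mfilter => /andP[/= sel mv].
  rewrite lem_mlcm (msupp_homogenize mv) andbT.
  by move: sel; rewrite /select_gen; case: pickP => // g' ? /eqP[<-].
exists w; apply: homogenize_inj => -[//|h t] st.
rewrite {2}/homogenize bd_homogenize //.
have -> : bd (homogenize w) (h :: t) = bd c (h :: t).
  by apply: eq_bd => s ss _; apply: wc; rewrite ss st.
rewrite bd_cone bdv ?raddf0 ?addr0; last by case: st.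
rewrite (@sum_select_part _ h) // => m /msupp_homogenize.
by rewrite lem_mlcm => /andP[].
Qed.

Lemma bd_homogenize_diff i (w : 'rV[S]_(taylor_rank i.+1)) t : size t = i ->
  bd (homogenize (w *m taylor_diff i)) t = 0.
Proof.
move=> st; rewrite -[RHS](bd_bd (homogenize w) t).
by apply: eq_bd => s ss _; rewrite /homogenize bd_homogenize // ss st.
Qed.

Lemma taylor_exact0 (v : 'rV[S]_(taylor_rank 0)) :
  v *m taylor_aug = 0 <-> exists w, v = w *m taylor_diff 0.
Proof.
split=> [v0|[w ->]].
  by apply: taylor_exact => t /size0nil ->; rewrite -taylor_augE v0 mxE.
by apply/rowP => j; rewrite ord1 taylor_augE bd_homogenize_diff // mxE.
Qed.

Lemma taylor_exactS i (v : 'rV[S]_(taylor_rank i.+1)) :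
  v *m taylor_diff i = 0 <-> exists w, v = w *m taylor_diff i.+1.
Proof.
split=> [v0|[w ->]].
  apply: taylor_exact => t st; rewrite -bd_homogenize // v0.
  by rewrite -[t]/(tval (Tuple (introT eqP st))) chain_of_tuple mxE mul0r.
apply: homogenize_inj => t st.
rewrite {1}/homogenize bd_homogenize // bd_homogenize_diff // /homogenize.
by rewrite -[t]/(tval (Tuple (introT eqP st))) chain_of_tuple mxE mul0r.
Qed.

Lemma taylor_aug_homog b m :
  m \in msupp (taylor_aug b 0) -> (mdeg m)%:Z = taylor_shift b.
Proof. by rewrite mxE => /mem_msuppXP <-. Qed.

Lemma taylor_diff_homog i a b m :
  m \in msupp (taylor_diff i a b) ->
  (mdeg m)%:Z + taylor_shift b = taylor_shift a.
Proof.
rewrite mxE; set e := incidence _ _; have [->|nz] := eqVneq e 0.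
  by rewrite scale0r msupp0.
rewrite msuppMCX // inE => /eqP ->.
rewrite /taylor_shift -PoszD -mdegD submK //.
exact/lcm_gen_sub/incidence_sub.
Qed.

Lemma taylor_aug_image :
  range (fun v : 'rV_(taylor_rank 0) => (v *m taylor_aug) 0 0) =
  ideal_of_monomials K (range gen).
Proof.
apply/seteqP; split=> [_ [v _ <-]|f [r rG ->]].
  rewrite mxE.
  exists [seq (v 0 a, lcm_gen (simplex a)) | a : 'I_(taylor_rank 0)].
    move=> p /mapP[a _ ->] /=; case/tupleP: (simplex a) => g s.
    by exists g; rewrite // tuple0 lcm_gen1.
  by rewrite big_map big_enum /=; apply: eq_bigr => a _; rewrite mxE.
elim: r rG => [|[p m] r IH] rG.
  by rewrite big_nil; exists 0; rewrite // mul0mx mxE.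
have [|v _ vr] := IH; first by move=> q qr; apply: rG; rewrite inE qr orbT.
have [g _ /= gm] := rG _ (mem_head _ _).
exists (p *: delta_mx 0 (enum_rank [tuple g]) + v) => //=.
rewrite big_cons /= -vr mulmxDl mxE -scalemxAl; congr (_ + _).
by rewrite mxE -rowE !mxE simplexK lcm_gen1 gm.
Qed.

Definition taylor_resolution :
    graded_free_resolution (ideal_of_monomials K (range gen)) :=
  GradedFreeResolution taylor_aug_homog taylor_diff_homog taylor_aug_image
    taylor_exact0 taylor_exactS.

End TaylorResolution.

(** * Degree-preserving matrices and their constant coefficients *)

Section HomogeneousMatrices.
Context (K : fieldType) (n : nat).
Local Notation S := {mpoly K[n]}.

Definition mx_homog p q (s : 'I_p -> int) (t : 'I_q -> int)
    (A : 'M[S]_(p, q)) :=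
  forall a b m, m \in msupp (A a b) -> (mdeg m)%:Z + t b = s a.

Definition homog_part p q (s : 'I_p -> int) (t : 'I_q -> int)
    (A : 'M[S]_(p, q)) : 'M[S]_(p, q) :=
  \matrix_(a, b) mfilter [pred m | (mdeg m)%:Z + t b == s a] (A a b).

Lemma homog_part_homog p q (s : 'I_p -> int) (t : 'I_q -> int) A :
  mx_homog s t (homog_part s t A).
Proof. by move=> a b m; rewrite mxE msupp_mfilter => /andP[/eqP]. Qed.

Lemma homog_part_id p q (s : 'I_p -> int) (t : 'I_q -> int) A :
  mx_homog s t A -> homog_part s t A = A.
Proof.
move=> hA; apply/matrixP => a b; rewrite mxE mfilter_id // => m /hA /= ->.
exact: eqxx.
Qed.

(** Hence a lift of a homogeneous map through a homogeneous map remains a lift when replaced by its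
    homogeneous part. *)
Lemma homog_part_mulmx p q r (s : 'I_p -> int) (t : 'I_q -> int)
    (u : 'I_r -> int) A B :
  mx_homog t u B -> homog_part s u (A *m B) = homog_part s t A *m B.
Proof.
move=> hB; apply/matrixP => a b; rewrite !mxE raddf_sum; apply: eq_bigr => c _.
rewrite mxE; apply: mfilterM => m' /hB <- m /=.
by rewrite mdegD PoszD addrA.
Qed.

Lemma mx_homog_mul p q r (s : 'I_p -> int) (t : 'I_q -> int)
    (u : 'I_r -> int) A B :
  mx_homog s t A -> mx_homog t u B -> mx_homog s u (A *m B).
Proof.
move=> hA hB; rewrite -[A](homog_part_id hA) -(homog_part_mulmx s _ hB).
exact: homog_part_homog.
Qed.

Definition mx_const p q (A : 'M[S]_(p, q)) : 'M[K]_(p, q) :=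
  map_mx (mcoeff 0%MM) A.

Lemma mx_homog_const p q (s : 'I_p -> int) (t : 'I_q -> int) A a b :
  mx_homog s t A -> mx_const A a b != 0 -> s a = t b.
Proof.
by move=> hA; rewrite mxE -mcoeff_msupp => /hA <-; rewrite mdeg0 add0r.
Qed.

Lemma mulmx_rows (R : pzRingType) p q r (A : 'M[R]_(p, r)) (B : 'M[R]_(q, r)) :
  (forall a, exists w, row a A = w *m B) -> exists W, A = W *m B.
Proof.
move=> /choice[w wA]; exists (\matrix_a w a).
by apply/row_matrixP => a; rewrite wA row_mul rowK.
Qed.

End HomogeneousMatrices.

(** * Lifting through a resolution, and vanishing of Betti numbers *)

Section Resolution.
Context (K : fieldType) (n : nat) (I : set {mpoly K[n]}).
Variable F : graded_free_resolution I.
Local Notation S := {mpoly K[n]}.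

Lemma diff_homog i :
  mx_homog (@res_shift _ _ _ F i.+1) (@res_shift _ _ _ F i) (res_diff F i).
Proof. by move=> a b m; apply: res_diff_homog. Qed.

Lemma aug_homog :
  mx_homog (@res_shift _ _ _ F 0) (fun _ : 'I_1 => 0) (res_aug F).
Proof. by move=> a b m; rewrite ord1 addr0; apply: res_aug_homog. Qed.

Lemma diff_diff i : res_diff F i.+1 *m res_diff F i = 0.
Proof.
apply/row_matrixP => a; rewrite row_mul row0.
by apply/res_exactS; exists (delta_mx 0 a); rewrite rowE.
Qed.

Lemma lift_diff i p (A : 'M_(p, res_rank F i.+1)) :
  A *m res_diff F i = 0 -> exists W, A = W *m res_diff F i.+1.
Proof.
move=> A0; apply: mulmx_rows => a; apply/res_exactS.
by rewrite -row_mul A0 row0.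
Qed.

Lemma lift_diff0 p (A : 'M_(p, res_rank F 0)) :
  A *m res_aug F = 0 -> exists W, A = W *m res_diff F 0.
Proof.
move=> A0; apply: mulmx_rows => a; apply/res_exact0.
by rewrite -row_mul A0 row0.
Qed.

Lemma res_aug_imageP p :
  I p <-> exists v : 'rV_(res_rank F 0), (v *m res_aug F) 0 0 = p.
Proof.
have <- : range (fun v : 'rV_(res_rank F 0) => (v *m res_aug F) 0 0) p = I p.
  by rewrite res_aug_image.
by split=> [[v _ <-]|[v <-]]; exists v.
Qed.

Lemma lift_aug p (A : 'cV_p) : (forall a, I (A a 0)) ->
  exists W, A = W *m res_aug F.
Proof.
move=> IA; apply: mulmx_rows => a; have /res_aug_imageP[w wA] := IA a.
by exists w; apply/rowP => j; rewrite ord1 wA mxE.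
Qed.

Lemma aug_mem a : I (res_aug F a 0).
Proof.
by apply/res_aug_imageP; exists (delta_mx 0 a); rewrite -rowE mxE.
Qed.

Definition in_degree i (j : int) (v : 'rV[K]_(res_rank F i)) : Prop :=
  forall b, v 0 b != 0 -> res_shift b = j.

Definition tensor_cycle i : 'rV[K]_(res_rank F i) -> Prop :=
  if i is i'.+1 then fun v => v *m tensor_diff F i' = 0 else fun=> True.

Lemma in_degree_comp i j (v : 'rV_(res_rank F i)) :
  in_degree j v -> v *m tensor_comp F i j = v.
Proof.
move=> vj; apply/rowP => b; rewrite mul_mx_diag !mxE.
have [->|/vj ->] := eqVneq (v 0 b) 0; first by rewrite mul0r.
by rewrite eqxx mulr1.
Qed.

Lemma sub_tensor_comp i j (v : 'rV_(res_rank F i)) :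
  (v <= tensor_comp F i j)%MS <-> in_degree j v.
Proof.
split=> [/submxP[w ->] b|/in_degree_comp vj]; last by rewrite -vj submxMl.
rewrite mul_mx_diag !mxE; case: (_ =P j) => // _.
by rewrite mulr0 eqxx.
Qed.

Lemma sub_tensor_cycles i j (v : 'rV_(res_rank F i)) :
  (v <= tensor_cycles F i j)%MS <-> in_degree j v /\ tensor_cycle v.
Proof.
case: i v => [|i] v /=.
  by split=> [/sub_tensor_comp|[/sub_tensor_comp]].
by rewrite sub_capmx; split=> [/andP[/sub_tensor_comp ? /sub_kermxP]|
  [/sub_tensor_comp ? /sub_kermxP ?]]; last apply/andP.
Qed.

Lemma tensor_comp_diff i j :
  tensor_comp F i.+1 j *m tensor_diff F i =
  tensor_diff F i *m tensor_comp F i j.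
Proof.
apply/matrixP => a b; rewrite mul_diag_mx mul_mx_diag !mxE mulrC.
have [->|nz] := eqVneq ((res_diff F i a b)@_0%MM) 0; first by rewrite !mul0r.
by rewrite (@mx_homog_const _ _ _ _ _ _ _ a b (@diff_homog i)) // mxE.
Qed.

Lemma tensor_boundaries_sub i j :
  (tensor_boundaries F i j <= tensor_cycles F i j)%MS.
Proof.
apply/row_subP => a; apply/sub_tensor_cycles; split.
  apply/sub_tensor_comp; rewrite /tensor_boundaries tensor_comp_diff.
  exact/(submx_trans (row_sub _ _))/submxMl.
case: i a => // i a; rewrite /= -row_mul -mulmxA -map_mxM diff_diff.
by rewrite map_mx0 mulmx0 row0.
Qed.

(** [betti] is a truncated difference of ranks; as boundaries are cycles, it vanishes exactly when
    the two spaces agree. The preimage [w] may be inhomogeneous: its degree [j] component has the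
    same image, by [tensor_comp_diff]. *)
Lemma betti_eq0P i j : betti F i j = 0%N <->
  forall v : 'rV_(res_rank F i), in_degree j v -> tensor_cycle v ->
    exists w, v = w *m tensor_diff F i.
Proof.
split=> [b0 v vj vc|ex].
  have : (v <= tensor_cycles F i j)%MS by apply/sub_tensor_cycles.
  have [_ eqr] := mxrank_leqif_sup (tensor_boundaries_sub i j).
  have : (\rank (tensor_cycles F i j) <= \rank (tensor_boundaries F i j))%N.
    by rewrite -subn_eq0; apply/eqP.
  have := mxrankS (tensor_boundaries_sub i j) => le1 le2.
  move: eqr; rewrite eqn_leq le1 le2 => /esym cb /submx_trans /(_ cb).
  by move=> /submxP[w ->]; exists (w *m tensor_comp F i.+1 j); rewrite mulmxA.
apply/eqP; rewrite subn_eq0 mxrankS //; apply/row_subP => a.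
have /sub_tensor_cycles[vj vc] := row_sub a (tensor_cycles F i j).
have [w wE] := ex _ vj vc.
apply/submxP; exists w; rewrite /tensor_boundaries tensor_comp_diff mulmxA -wE.
exact/esym/in_degree_comp.
Qed.

End Resolution.

(** * Independence of the resolution *)

Section Comparison.
Context (K : fieldType) (n : nat) (I : set {mpoly K[n]}).
Local Notation S := {mpoly K[n]}.
Implicit Types F : graded_free_resolution I.

(* f is the degree i part of a chain map lifting multiplication by c on I.    *)
Fixpoint chain_map F F' (c : S) i :
    'M[S]_(res_rank F i, res_rank F' i) -> Prop :=
  match i with
  | 0 => fun f => f *m res_aug F' = c *: res_aug F
  | i'.+1 => fun f => exists2 f', chain_map c f' &
      f *m res_diff F' i' = res_diff F i' *m f'
  end.

Lemma chain_map1 F i : chain_map 1 (1%:M : 'M_(res_rank F i)).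
Proof.
elim: i => [|i IH] /=; first by rewrite mul1mx scale1r.
by exists 1%:M; rewrite // mul1mx mulmx1.
Qed.

Lemma chain_mapM F F' F'' i (f : 'M_(res_rank F i, res_rank F' i))
    (g : 'M_(res_rank F' i, res_rank F'' i)) :
  chain_map 1 f -> chain_map 1 g -> chain_map 1 (f *m g).
Proof.
elim: i f g => [|i IH] f g /=.
  by move=> fE gE; rewrite -mulmxA gE -scalemxAr fE !scale1r.
move=> [f' cf' ff'] [g' cg' gg']; exists (f' *m g'); first exact: IH.
by rewrite -mulmxA gg' !mulmxA ff'.
Qed.

Lemma chain_mapB F F' c c' i (f g : 'M_(res_rank F i, res_rank F' i)) :
  chain_map c f -> chain_map c' g -> chain_map (c - c') (f - g).
Proof.
elim: i f g => [|i IH] f g /=; first by rewrite mulmxBl scalerBl => -> ->.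
move=> [f' cf' ff'] [g' cg' gg']; exists (f' - g'); first exact: IH.
by rewrite mulmxBl mulmxBr ff' gg'.
Qed.

Lemma exists_chain_map F F' i :
  exists2 f : 'M_(res_rank F i, res_rank F' i),
    mx_homog (@res_shift _ _ _ F i) (@res_shift _ _ _ F' i) f & chain_map 1 f.
Proof.
elim: i => [|i [f hf cf]] /=.
  have [f fE] := lift_aug F' (@aug_mem _ _ _ F).
  pose h := homog_part (@res_shift _ _ _ F 0) (@res_shift _ _ _ F' 0) f.
  exists h; first exact: homog_part_homog.
  rewrite scale1r -(homog_part_mulmx _ _ (@aug_homog _ _ _ F')) -fE.
  exact/homog_part_id/aug_homog.
have [f' f'E] : exists f', res_diff F i *m f = f' *m res_diff F' i.
  case: i f hf cf => [|i] f hf /=.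
    move=> fE; apply: lift_diff0; rewrite -mulmxA fE scale1r.
    by apply/row_matrixP => a; rewrite row0 row_mul; apply/res_exact0;
      exists (delta_mx 0 a); rewrite rowE.
  move=> [f' _ ff']; apply: lift_diff; rewrite -mulmxA ff' mulmxA diff_diff.
  by rewrite mul0mx.
pose h := homog_part (@res_shift _ _ _ F i.+1) (@res_shift _ _ _ F' i.+1) f'.
exists h; first exact: homog_part_homog.
exists f => //; rewrite -(homog_part_mulmx _ _ (@diff_homog _ _ _ F' i)) -f'E.
exact/homog_part_id/(mx_homog_mul _ hf)/diff_homog.
Qed.

(* A chain map over 0 is null-homotopic; after subtraction of the boundary    *)
(* part h *m d it factors through the previous differential.                  *)
Lemma chain_map0_homotopy F F' i (f : 'M_(res_rank F i, res_rank F' i)) :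
    chain_map 0 f ->
  exists h, res_diff F i *m (f - h *m res_diff F' i) = 0 /\
    forall v : 'rV_(res_rank F i), tensor_cycle v ->
      v *m mx_const (f - h *m res_diff F' i) = 0.
Proof.
elim: i f => [|i IH] f /=.
  rewrite scale0r => /lift_diff0[h ->]; exists h.
  rewrite subrr mulmx0; split=> // v _.
  by rewrite /mx_const map_mx0 mulmx0.
move=> [f' /IH[h' [dE _]] ff'].
have /lift_diff[h hE] : (f - res_diff F i *m h') *m res_diff F' i = 0.
  by rewrite mulmxBl ff' -mulmxA -mulmxBr.
exists h; rewrite -hE opprB addrC subrK mulmxA diff_diff mul0mx.
split=> // v vc.
by rewrite /mx_const map_mxM mulmxA vc mul0mx.
Qed.

(** Push the cycle [v] to [F'] by [f], write it there as a boundary, and bring it back by [g]; the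
    error [v * (1 - f * g)] is a boundary because [1 - f * g] lifts 0. *)
Lemma betti_eq0_trans F F' i j : betti F' i j = 0%N -> betti F i j = 0%N.
Proof.
move=> /betti_eq0P ex; apply/betti_eq0P => v vj vc.
have [f hf cf] := exists_chain_map F F' i.
(* The lift is taken one degree higher: [g1] carries the preimage [w] along, while [g] is its
   companion in degree [i]. *)
have [g1 _ [g cg g1E]] := exists_chain_map F' F i.+1.
have [w wE] : exists w, v *m mx_const f = w *m tensor_diff F' i.
  apply: ex => [b|].
    rewrite mxE; apply: contra_neqP => bj; apply: big1 => a _.
    have [->|va] := eqVneq (v 0 a) 0; first by rewrite mul0r.
    have [->|fab] := eqVneq (mx_const f a b) 0; first by rewrite mulr0.
    by case: bj; rewrite -(mx_homog_const hf fab) (vj a).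
  clear vj g1E cg g g1 hf; case: i f cf v vc => //= i f [f' _ ff'] v vc.
  by rewrite -mulmxA -map_mxM ff' map_mxM mulmxA [v *m _]vc mul0mx.
have := chain_mapB (chain_map1 F i) (chain_mapM cf cg); rewrite subrr.
move=> /chain_map0_homotopy[h [_ /(_ v vc) hE]].
exists (w *m mx_const g1 + v *m mx_const h).
have g1E' : mx_const g1 *m tensor_diff F i = tensor_diff F' i *m mx_const g.
  by rewrite -!map_mxM g1E.
rewrite mulmxDl -[w *m _ *m _]mulmxA g1E' mulmxA -wE.
apply/eqP; rewrite -subr_eq0 -[v in v - _]mulmx1 opprD addrA -!mulmxA -!mulmxBr.
rewrite -[X in _ == X]hE; apply/eqP; congr (_ *m _).
by rewrite /mx_const !map_mxB map_mx1 !map_mxM.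
Qed.

(** Only vanishing is compared, which is all that [tmax], [projdim] and [reg] depend on. *)
Lemma betti_unique F F' i j : betti F i j = 0%N <-> betti F' i j = 0%N.
Proof. by split; apply: betti_eq0_trans. Qed.

End Comparison.

(** * Tor of the Taylor-type resolution, split by lcm *)

Section TaylorBetti.
Context (K : fieldType) (n : nat) (T : finType) (gen : T -> 'X_{1..n}).
Implicit Types (s t : seq T) (a : 'X_{1..n}) (i : nat) (c z : seq T -> K).
Local Notation lcm_gen := (lcm_gen gen).
Local Notation F := (taylor_resolution K gen).

Definition restrict (P : pred (seq T)) c s : K := if P s then c s else 0.

Definition same_lcm t : pred (seq T) := [pred s | lcm_gen s == lcm_gen t].

(** The entry [x^(lcm s - lcm t)] has constant coefficient 1 if the lcms agree and 0 otherwise, so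
    over K only simplices with the lcm of [t] contribute. *)
Lemma chain_of_tensor_diff i (v : 'rV[K]_(res_rank F i.+1)) t :
    size t = i.+1 ->
  chain_of (v *m tensor_diff F i : 'rV_(taylor_rank T i)) t =
  bd (restrict (same_lcm t) (chain_of (v : 'rV_(taylor_rank T i.+1)))) t.
Proof.
move=> st; rewrite [RHS](@bd_tuples_ring T K _ _ _ st).
rewrite -[t in LHS]/(tval (Tuple (introT eqP st))).
rewrite chain_of_mulmx; apply: eq_bigr => s _.
rewrite mxE mxE !simplexK /= -/(incidence K s t) mcoeffZ mcoeffX /restrict /=.
have [->|nz] := eqVneq (incidence K s t) 0; first by rewrite mul0r mulr0 mul0r.
have le_ts := lcm_gen_sub gen (incidence_sub nz).
have -> : (lcm_gen s - lcm_gen t == 0)%MM = (lcm_gen s == lcm_gen t).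
  apply/eqP/eqP => [st0|->]; first by rewrite -(submK le_ts) st0 add0m.
  by apply/mnmP => k; rewrite mnmBE subnn mnm0E.
rewrite /same_lcm /= mulrCA; congr (_ * _).
by case: eqP => _; rewrite (mulr1, mulr0).
Qed.

(* The vanishing of Tor_i in degree m, in terms of chains on the simplices of *)
(* a given lcm.                                                               *)
Definition exact_in_degree i (m : nat) : Prop := forall c,
    (forall t, size t = i.+1 -> c t != 0 -> mdeg (lcm_gen t) = m) ->
    ((0 < i)%N -> forall t, size t = i -> bd (restrict (same_lcm t) c) t = 0) ->
  exists y, forall t, size t = i.+1 -> c t = bd (restrict (same_lcm t) y) t.

Lemma betti_exact_in_degree i (m : nat) :
  betti F i m%:Z = 0%N -> exact_in_degree i m.
Proof.
move=> /betti_eq0P ex c cm cc; pose v : 'rV_(taylor_rank T i) := row_of i c.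
have [b||w wE] := ex v.
- rewrite mxE => /cm cb; rewrite /= /taylor_shift cb //.
  by rewrite size_tuple.
- case: i ex cm @v cc => //= i _ cm cc; apply: chain_of_inj => t.
  rewrite chain_of_tensor_diff ?size_tuple // chain_of_tuple mxE.
  rewrite -(cc isT t (size_tuple t)); apply: eq_bd => s ss _.
  by rewrite /restrict row_ofK // ss size_tuple.
- exists (chain_of (w : 'rV_(taylor_rank T i.+1))) => t st.
  by rewrite -chain_of_tensor_diff // -wE row_ofK.
Qed.

(** * Filling cycles in one multidegree [a], with a generator [u] dividing [a] *)

Section Multidegree.
Variables (a : 'X_{1..n}) (u : T).
Hypothesis ua : (gen u <= a)%MM.

Let below s := (lcm_gen s <= a)%MM && (lcm_gen s != a).
Let bad s := mlcm (gen u) (lcm_gen s) == a.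
Let cone_u c := cone (fun g x => (g == u)%:R * x) c.

Lemma bd_cone_u c h t : bd c t = 0 -> bd (cone_u c) (h :: t) = c (h :: t).
Proof.
move=> c0; rewrite /cone_u.
rewrite (@bd_cone T K (fun g => (g == u)%:R \*o idfun)) /=.
rewrite c0 mulr0 subr0 (bigD1 u) //= eqxx mul1r big1 ?addr0 // => g /negPf ->.
by rewrite mul0r.
Qed.

Lemma below_sub s t : {subset t <= s} -> below s -> below t.
Proof.
move=> /(lcm_gen_sub gen) ts /andP[sa nsa].
rewrite /below (lepm_trans ts sa) /=.
by apply: contra_neq nsa => ta; apply: lem_antisym; rewrite // -ta.
Qed.

Lemma below_bad s t : {subset t <= s} -> below s -> bad t -> bad s.
Proof.
move=> /(lcm_gen_sub gen) ts /andP[sa _] /eqP bt; apply/eqP; apply: lem_antisym.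
  by rewrite lem_mlcm ua.
by rewrite -bt lem_mlcm lem_mlcml (lepm_trans ts) // lem_mlcmr.
Qed.

(* The bad simplices, those that the cone over u does not keep below a, are   *)
(* removed from a cycle z in the order of decreasing degree of their lcm.     *)
Lemma cycle_below i (m : nat) z :
    (forall k, (k < mdeg a)%N -> (mdeg a <= k + mdeg (gen u))%N ->
      exact_in_degree i k) ->
    (forall t, size t = i.+1 -> z t != 0 -> below t) ->
    (forall t, size t = i -> bd z t = 0) ->
    (forall t, size t = i.+1 -> z t != 0 -> bad t ->
      (mdeg (lcm_gen t) < m)%N) ->
  exists w, (forall s, size s = i.+2 -> w s != 0 -> below s) /\
    forall t, size t = i.+1 -> bd w t = z t.
Proof.
move=> ex; elim: m z => [|m IH] z zb zc zm.
  (* No bad simplex is left in the support of [z], so the cone over [u] stays strictly below [a]. *)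
  exists (cone_u z); split=> [[//|g t] [st]|[//|h t] [st]].
    rewrite /cone_u /=; have [->|_] := eqVneq g u; last by rewrite mul0r eqxx.
    rewrite mul1r => zt; rewrite /below /= lem_mlcm ua.
    have /andP[-> _] := zb _ st zt; apply/eqP => bt.
    by have := zm t st zt; rewrite /bad bt eqxx => /(_ isT).
  exact/bd_cone_u/zc.
pose B := [pred s | bad s && (mdeg (lcm_gen s) == m)].
have [[t [st zt]]|nB] :=
  pselect (exists t, size t = i.+1 /\ restrict B z t != 0); last first.
  apply: IH => // t st zt bt.
  have := zm t st zt bt; rewrite ltnS leq_eqVlt => /orP[/eqP tm|//].
  by case: nB; exists t; rewrite /restrict /= bt tm eqxx.
move: zt; rewrite /restrict /=.
case: ifP => [/andP[bt /eqP tm] zt|_]; last by rewrite eqxx.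
(* The hypothesis [ex] applies in degree [m]: a bad [t] of degree [m] below [a] gives
   [m < mdeg a <= m + mdeg (gen u)]. *)
have [y yE] : exists y, forall t, size t = i.+1 ->
    restrict B z t = bd (restrict (same_lcm t) y) t.
  apply: (ex m).
  - rewrite -tm; apply: mdeg_ltm; have /andP[] := zb _ st zt; first by [].
    by [].
  - by rewrite -tm addnC -[in leqLHS](eqP bt) mdeg_mlcm.
  - move=> s _; rewrite /restrict /=.
    by case: ifP => [/andP[_ /eqP]|]; rewrite ?eqxx.
  move=> i0 t' st'; have [/andP[bt' /eqP t'm]|Bt'] := boolP (B t'); last first.
    apply: bd_eq0 => s _ _; rewrite /restrict /same_lcm /=.
    have [ss'|//] := eqVneq (lcm_gen s) (lcm_gen t').
    by move: Bt'; rewrite /bad /= ss' => /negPf ->.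
  rewrite -[RHS](zc _ st'); apply: eq_bd => s ss ts.
  rewrite /restrict /same_lcm /=.
  have [ss'|ss'] := eqVneq (lcm_gen s) (lcm_gen t').
    by rewrite /bad ss' -/(bad t') bt' t'm eqxx.
  (* A simplex [s] in the support of [z] containing the bad [t'] is bad too; with a larger lcm its
     degree would exceed [m], against [zm]. *)
  apply/esym/eqP; apply: contraT => zs; rewrite st' in ss.
  have := zm s ss zs (below_bad ts (zb _ ss zs) bt').
  have := mdeg_ltm (lcm_gen_sub gen ts); rewrite eq_sym => /(_ ss'); lia.
(* Subtracting [bd y'] cancels the bad simplices of degree [m]; as [y'] lives below [a] in degree
   [m], nothing bad of higher degree arises and the support stays below [a]. *)
pose y' := restrict [pred s | B s && below s] y.
have [t' st'|t' st'|t' st'|w [wb wE]] := IH (fun s => z s - bd y' s).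
- apply: contraTT => nb; rewrite negbK.
  have -> : z t'= 0 by apply/eqP; apply: contraNT nb; apply: zb.
  rewrite sub0r oppr_eq0; apply/eqP/bd_eq0 => s _ ts.
  rewrite /y' /restrict /=; case: ifP => // /andP[_ /(below_sub ts)].
  by rewrite (negPf nb).
- by rewrite bdB bd_bd zc // subr0.
- move=> z't' bt'; rewrite ltnNge; apply: contra z't' => mt'.
  have [b't|nb] := boolP (below t'); last first.
    have -> : z t'= 0 by apply/eqP; apply: contraNT nb; apply: zb.
    rewrite sub0r oppr_eq0; apply/eqP/bd_eq0 => s _ ts.
    rewrite /y' /restrict /=; case: ifP => // /andP[_ /(below_sub ts)].
    by rewrite (negPf nb).
  have [t'm|nm] := eqVneq (mdeg (lcm_gen t')) m; last first.
    have -> : z t' = 0.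
      by apply/eqP; apply: contraT => /(zm _ st')/(_ bt'); lia.
    rewrite sub0r oppr_eq0; apply/eqP/bd_eq0 => s _ ts.
    rewrite /y' /restrict /=; case: ifP => // /andP[/andP[_ /eqP sm] _].
    by have := mdeg_lem (lcm_gen_sub gen ts); lia.
  have -> : z t' = restrict B z t' by rewrite /restrict /= bt' t'm eqxx.
  rewrite yE // subr_eq0; apply/eqP/eq_bd => s ss ts.
  rewrite /y' /restrict /same_lcm /=.
  have [ss'|ss'] := eqVneq (lcm_gen s) (lcm_gen t').
    by rewrite /bad /below ss' -/(bad t') -/(below t') bt' b't t'm eqxx.
  case: ifP => // /andP[/andP[_ /eqP sm] _]; exfalso.
  have := mdeg_ltm (lcm_gen_sub gen ts); rewrite eq_sym => /(_ ss'); lia.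
exists (fun s => w s + y' s); split=> [s ss|t' st']; last first.
  by rewrite bdD wE // subrK.
apply: contraTT => nb; rewrite negbK.
have -> : w s = 0 by apply/eqP; apply: contraNT nb; apply: wb.
by rewrite add0r /y' /restrict /= (negPf nb) andbF.
Qed.

(** The boundary of [c] lies strictly below [a], so [cycle_below] fills it by some [w] there. Then
    [c - w] is a cycle of the full complex, and its cone over [u] bounds it; [w] vanishes on
    simplices with lcm [a]. *)
Lemma multidegree_exact i c :
    (forall k, (k < mdeg a)%N -> (mdeg a <= k + mdeg (gen u))%N ->
      exact_in_degree i k) ->
    (forall s, size s = i.+2 -> c s != 0 -> lcm_gen s = a) ->
    (forall t, size t = i.+1 -> lcm_gen t = a -> bd c t = 0) ->
  exists b, forall s, size s = i.+2 -> lcm_gen s = a ->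
    c s = bd (restrict (fun s' => lcm_gen s' == a) b) s.
Proof.
move=> ex ca cc.
have bd_below t : size t = i.+1 -> bd c t != 0 -> below t.
  move=> st nz; apply/andP; split; last by apply: contra_neq nz => /(cc _ st).
  apply: contraNT nz => ta; apply/eqP/bd_eq0 => s ss ts; apply/eqP.
  rewrite st in ss; apply: contraNT ta => /(ca _ ss) <-.
  exact: lcm_gen_sub.
have [t st nz _|w [wb wE]] := cycle_below ex bd_below (fun t _ => bd_bd c t)
    (m := mdeg a).
  by have /andP[] := bd_below t st nz; apply: mdeg_ltm.
pose e s := c s - w s; exists (cone_u e) => s ss sa.
have -> : c s = bd (cone_u e) s.
  case: s ss sa => // h t [st] ta; rewrite bd_cone_u; last first.
    by rewrite bdB wE ?subrr.
  have w0 : w (h :: t) = 0.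
    apply/eqP; apply: contraT => /(wb (h :: t) (congr1 S st)).
    by rewrite /below ta eqxx andbF.
  by rewrite /e w0 subr0.
(* The cone only meets simplices whose lcm divides [a]; those containing [s] have lcm exactly [a],
   so the restriction loses nothing. *)
apply: eq_bd => -[|g t] //= [st] sgt; rewrite /restrict /cone_u.
have [//|gta] := eqVneq (lcm_gen (g :: t)) a.
rewrite /cone; have [gu|_] := eqVneq g u; last by rewrite mul0r.
rewrite mul1r; apply/eqP; apply: contraNT gta => et; apply/eqP/lem_antisym.
  rewrite -[lcm_gen _]/(mlcm (gen g) (lcm_gen t)) lem_mlcm gu ua andTb.
  rewrite ss in st.
  have [ct|/(ca _ st) ->] := eqVneq (c t) 0; last exact: lepm_refl.
  by move: et; rewrite /e ct sub0r oppr_eq0 => /(wb _ st) /andP[].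
by rewrite -[X in (X <= _)%MM]sa; apply: (lcm_gen_sub gen sgt).
Qed.

End Multidegree.

(** The part of a cycle with a given lcm is filled by [multidegree_exact], and the fillings are
    glued over all lcms. *)
Lemma taylor_betti_eq0 i (j : int) (d : nat) :
    (forall u, (mdeg (gen u) <= d)%N) ->
    (forall j', j' < j -> j <= j' + d%:Z -> betti F i j' = 0%N) ->
  betti F i.+1 j = 0%N.
Proof.
move=> gd b0; apply/betti_eq0P => v vj vc.
pose c := chain_of (v : 'rV_(taylor_rank T i.+1)).
have cj s : c s != 0 -> size s = i.+2 /\ (mdeg (lcm_gen s))%:Z = j.
  move=> nz; have /eqP ss : size s == i.+2.
    by apply: contraNT nz => ss; rewrite /c chain_of_size.
  split=> //; rewrite -(vj (enum_rank (Tuple (introT eqP ss)))).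
    by rewrite /= /taylor_shift simplexK.
  by rewrite -chain_of_tuple.
have /choice[b bE] a : exists b, forall s, size s = i.+2 -> lcm_gen s = a ->
    c s = bd (restrict (fun s' => lcm_gen s' == a) b) s.
  have [[s [sa cs]]|nc] :=
    pselect (exists s, lcm_gen s = a /\ c s != 0); last first.
    exists (fun=> 0) => s _ sa; rewrite bd_eq0 => [|s' _ _].
      by apply/eqP; apply: contra_notT nc => cs; exists s.
    by rewrite /restrict if_same.
  (* The apex is the head of some simplex with lcm [a] in the support, hence divides [a]. *)
  have [ss mj] := cj s cs; case: s => [//|u s] in ss sa cs mj *.
  have ua : (gen u <= a)%MM by rewrite -sa /= lem_mlcml.
  rewrite sa in mj.
  have [k ka ku|s' _|t st ta|w wE] :=
      @multidegree_exact a u ua i (restrict (fun s' => lcm_gen s' == a) c).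
  - apply: betti_exact_in_degree; apply: b0; rewrite -mj; first by lia.
    by have := gd u; lia.
  - by rewrite /restrict; have [//|_] := eqVneq (lcm_gen s') a; rewrite eqxx.
  - rewrite -ta -/(same_lcm t) -(chain_of_tensor_diff v st) vc.
    by rewrite -[t]/(tval (Tuple (introT eqP st))) chain_of_tuple mxE.
  exists w => s' ss' sa'; rewrite -wE // /restrict sa' eqxx.
  by [].
pose B s := b (lcm_gen s) s.
exists (row_of i.+2 B : 'rV_(taylor_rank T i.+2)).
apply: chain_of_inj => t; rewrite chain_of_tensor_diff ?size_tuple //.
rewrite -/c (bE (lcm_gen t)) ?size_tuple //; apply: eq_bd => s ss _.
rewrite size_tuple in ss; rewrite /restrict /same_lcm /= row_ofK // /B.
by case: eqP => // ->.
Qed.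

Lemma taylor_betti0_le (j : int) (d : nat) :
  (forall u, (mdeg (gen u) <= d)%N) -> betti F 0 j != 0%N -> j <= d%:Z.
Proof.
move=> gd; apply: contraNT; rewrite -ltNge => dj.
apply/eqP/betti_eq0P => v vj _.
exists 0; rewrite mul0mx; apply/rowP => b; rewrite mxE.
apply/eqP; apply: contraT => /vj bj; move: dj; rewrite -bj /= /taylor_shift.
case/tupleP: (simplex b) => g s; rewrite tuple0 lcm_gen1.
by have := gd g; lia.
Qed.

End TaylorBetti.

(** * From the degree step to the bounds on [tmax] and [reg] *)

Section Bounds.
Context (K : fieldType) (n : nat) (I : set {mpoly K[n]}).
Variables (F : graded_free_resolution I) (d : nat).

Hypothesis betti0_le : forall j, betti F 0 j != 0%N -> j <= d%:Z.
Hypothesis betti_step : forall i j, betti F i.+1 j != 0%N ->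
  exists j', [/\ betti F i j' != 0%N, j' < j & j <= j' + d%:Z].

Lemma betti_le_tmax i j : betti F i j != 0%N -> (j%:E <= tmax F i)%E.
Proof. by move=> bij; apply: (supremum_ereal_int _).1; exists j. Qed.

Lemma tmax_le i x : (forall j, betti F i j != 0%N -> (j%:E <= x)%E) ->
  (tmax F i <= x)%E.
Proof.
by move=> bx; apply: (supremum_ereal_int _).2 => _ [j bij <-]; apply: bx.
Qed.

Lemma tmaxS_le i : (tmax F i.+1 <= tmax F i + (d%:Z)%:E)%E.
Proof.
apply: tmax_le => j /betti_step[j' [/betti_le_tmax bj' _ jj']].
by apply: le_trans (leeD2r _ bj'); rewrite -EFinD lee_fin.
Qed.

Lemma betti_le i j : betti F i j != 0%N -> j <= d%:Z * (i%:Z + 1).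
Proof.
elim: i j => [|i IH] j bij; first by have := betti0_le bij; lia.
by have [j' [/IH]] := betti_step bij; lia.
Qed.

(** For [d = 0] the window [j' < j <= j' + d] is empty. *)
Lemma betti_d0 i j : d = 0%N -> betti F i j != 0%N -> i = 0%N.
Proof. by case: i => // i d0 /betti_step[j' [_]]; lia. Qed.

Lemma reg_le :
  (reg F <= projdim F * (d%:Z - 1)%R%:E + (d%:Z)%:E)%E.
Proof.
apply: (supremum_ereal_int _).2 => _ [i _ <-].
rewrite leeBlDr //; apply: tmax_le => j bij.
have iF : ((i%:Z)%:E <= projdim F)%E.
  by apply: (supremum_ereal_int _).1; exists i => //; exists j.
(* For d = 0 the coefficient d - 1 is negative, so projdim F <= 0 is needed.  *)
have [d0|d0] := eqVneq d 0%N.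
  have F0 : (projdim F <= 0%:E)%E.
    apply: (supremum_ereal_int _).2 => _ [k [l kl] <-].
    by rewrite (betti_d0 d0 kl).
  have -> : projdim F = 0%:E.
    by apply/eqP; rewrite eq_le F0 (le_trans _ iF) // lee_fin.
  rewrite mul0e add0e -EFinD lee_fin; have := betti_le bij.
  by rewrite (betti_d0 d0 bij); lia.
have jd := betti_le bij.
case: (projdim F) iF => [r| |] //.
- rewrite lee_fin -EFinM -!EFinD lee_fin => ir; nia.
(* Here [projdim F] is [+oo]. For [d = 1] its product with 0 is 0 by convention and [j <= i + 1]
   suffices; for larger [d] the right-hand side is [+oo]. *)
- move=> _; have [d1|d1] := eqVneq d 1%N.
    by rewrite d1 subrr mule0 add0e -EFinD lee_fin; move: jd; rewrite d1; lia.
  by rewrite gt0_mulye ?lte_fin; [rewrite !addye // leey|lia].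
Qed.

End Bounds.

Theorem corollary3p6 (K : fieldType) (n : nat) (I : set {mpoly K[n]})
    (I_monomial : monomial_ideal I)
    (I_neq0 : exists2 f, I f & f != 0)
    (F : graded_free_resolution I)
    (G : set 'X_{1..n}) (G_min : minimal_monomial_generators I G)
    (d : nat) (d_max : is_maximum [set mdeg u | u in G] d) :
  (forall i : nat, tmax F i.+1 <= tmax F i + (d%:Z)%:E)%E /\
  (reg F <= projdim F * (d%:Z - 1)%R%:E + (d%:Z)%:E)%E.
Proof.
case: G_min d_max => IG _ [_ Gd].
(* The degree bound makes [G] a finite type; the bound in the type is strict, hence [d.+1]. *)
pose T : finType := {m : 'X_{1..n < d.+1} | `[< G m >]}.
pose gen (g : T) : 'X_{1..n} := bmnm (val g).
have gen_le g : (mdeg (gen g) <= d)%N by rewrite -ltnS bmdeg.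
have rangeG : range gen = G.
  apply/seteqP; split=> [_ [g _ <-]|m Gm]; first exact: (asboolW (valP g)).
  have md : (mdeg m < d.+1)%N by rewrite ltnS; apply: Gd; exists m.
  have Gm' : `[< G (BMultinom md) >] by apply/asboolP.
  by exists (exist _ (BMultinom md) Gm').
rewrite -rangeG in IG; subst I.
have bettiE i j :
    betti F i j = 0%N <-> betti (taylor_resolution K gen) i j = 0%N.
  exact: betti_unique.
have betti0_le j : betti F 0 j != 0%N -> j <= d%:Z.
  move=> /eqP/bettiE/eqP; exact: taylor_betti0_le.
have betti_step i j : betti F i.+1 j != 0%N ->
    exists j', [/\ betti F i j' != 0%N, j' < j & j <= j' + d%:Z].
  apply: contraNP => nex; apply/eqP/bettiE; apply: (taylor_betti_eq0 gen_le).
  move=> j' lt le; apply/bettiE/eqP; apply: contra_notT nex => nz.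
  by exists j'.
by split; [exact: tmaxS_le|exact: reg_le].
Qed.
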